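(* Let $f(z_1,z_2)$ be a germ of an analytic function near $(0,0)\in\mathbb{C}^2$, i.e. a power series in two variables with complex coefficients and positive radius of convergence. Let $a_1,a_2$ be complex numbers with $|a_1|<1$ and $|a_2|<1$. Let $M\geq 0$ be an integer such that $(a_1^n,a_2^n)$ lies in the domain of definition of $f$ for every $n\geq M$. Then the zero set $\{n\geq M\mid f(a_1^n,a_2^n)=0\}$ is almost periodic.
   Context: $\mathbb{Z}_+$ is the set of positive integers and $\mathbb{N}=\mathbb{Z}_+\cup\{0\}$. An arithmetic progression is a set of the form $\{a+bm\mid m\in\mathbb{N}\}$ with $a,b\in\mathbb{N}$ (in particular it can be a singleton). A subset $A\subseteq\mathbb{N}$ is very sparse if, for each $m\in\mathbb{Z}_+$, $|A\cap[0,n]|=o(\log^{(m)}(n))$ as $n\to\infty$, where $\log^{(m)}$ is the $m$-th iterated logarithm. A subset of $\mathbb{N}$ is almost periodic if it is the union of finitely many arithmetic progressions along with a very sparse set. The domain of definition of $f$ is an open neighbourhood of the origin on which the power series converges; $n$ ranges over natural numbers. *)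

(* Defs.v *)
From HB Require Import structures.
From mathcomp Require Import all_boot all_order all_algebra finmap complex.
From mathcomp Require Import all_classical all_reals all_analysis.
From mathcomp Require Import showcase.summability.

Set Implicit Arguments.
Unset Strict Implicit.
Unset Printing Implicit Defensive.

Import Order.TTheory GRing.Theory Num.Theory.
Import numFieldNormedType.Exports.

Local Open Scope classical_set_scope.
Local Open Scope ring_scope.

(* Two-variable power series are given by their coefficient families, with
   [c j k] the coefficient of z1 ^ j * z2 ^ k.  They are summed over
   [nat * nat] along the net of finite subsets, i.e., unconditionally; over the
   complex numbers this is the same as absolute convergence. *)
Section PowerSeries2.
Variable K : numFieldType.
Implicit Types (c : nat -> nat -> K) (z : K * K) (U : set (K * K)).

Definition ps2_term c z (jk : nat * nat) : K :=
  c jk.1 jk.2 * z.1 ^+ jk.1 * z.2 ^+ jk.2.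

Definition ps2_cvg c z : Prop := cvg (partial_sum (ps2_term c z) @ totally).

(* Meaningful only when [ps2_cvg c z]; [lim] is total. *)
Definition ps2_eval c z : K := lim (partial_sum (ps2_term c z) @ totally).

(* [U] may serve as the domain of definition of the germ given by [c]; such a
   [U] exists if and only if [c] has a positive radius of convergence. *)
Definition ps2_domain c U : Prop :=
  [/\ open U, U (0, 0) & forall z, U z -> ps2_cvg c z].

End PowerSeries2.

Definition arith_prog (a b : nat) : set nat :=
  [set (a + b * m)%N | m in [set: nat]].

(* [ln] is 0 on nonpositive reals, so the iterated logarithm is a total
   function; only its values for large [n] matter. *)
Definition very_sparse (R : realType) (A : set nat) : Prop :=
  forall m : nat, (0 < m)%N ->
    (fun n : nat => (#|` fset_set (A `&` [set k | (k <= n)%N])|)%:R : R^o)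
      =o_\oo (fun n : nat => iter m (@ln R) n%:R : R^o).

Definition almost_periodic (R : realType) (A : set nat) : Prop :=
  exists (s : seq (nat * nat)) (S : set nat),
    very_sparse R S /\
    A = \bigcup_(p in [set` s]) arith_prog p.1 p.2 `|` S.

(* Main.v *)
Require Import Defs.
From mathcomp Require Import all_boot all_order all_algebra complex finmap.
From mathcomp Require Import all_classical all_reals all_analysis.
From mathcomp Require Import ring lra zify.
From mathcomp Require Import showcase.summability.

Import Order.TTheory GRing.Theory Num.Theory.
Import numFieldNormedType.Exports.

Local Open Scope classical_set_scope.
Local Open Scope ring_scope.

Set Implicit Arguments.
Unset Strict Implicit.
Unset Printing Implicit Defensive.

(** The value [f (a1 ^ n, a2 ^ n)] is an infinite sum of exponentials
    [c * v ^ n], where [v] runs over the monomials [a1 ^ j * a2 ^ k] and [c] over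
    the coefficients of [f].  For large [n] the terms whose [v] has largest
    modulus decide whether the sum vanishes, so everything depends on how
    monomials of equal modulus differ.

    If there is [N > 0] such that monomials of equal nonzero modulus always have
    the same [N]-th power, then along each residue class modulo [N] the terms of
    a given modulus add up to a constant times a single exponential.  Either all
    these constants are zero and the values vanish along the class, or the first
    nonzero one dominates and only finitely many values vanish
    ([exp_sum_progression]).  This covers the case where [|a1|] and [|a2|] are
    multiplicatively independent or one of them is zero.

    Otherwise [|a1| ^ q = |a2| ^ p] with [p, q > 0].  Choosing [b] with
    [b ^ p = a1] gives [a1 = b ^ p] and [a2 = b ^ q * z] with [|z| = 1], and
    grouping by weight [p * j + q * k] turns the values into a series in [x = b ^ n]
    whose coefficients are polynomials [P l] in [y = z ^ n].  When [z] is a root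
    of unity the previous case applies.  When it is not, and the [P l] are not
    all zero, the zeros are very sparse, for the following reason.

    The first nonzero [P l] must be small at [y], so [y] is close to one of its
    finitely many roots [w].  After dividing all the [P l] by the largest common
    power of [X - w] (which loses at most one [n]), the series expanded at [w]
    contains a pure power of [x].  The finitely many monomials in [x] and
    [y - w] that are not negligible beside it have to cancel, so two of them are
    comparable.  This is the first step of a Newton polygon argument: it divides
    the zeros into finitely many classes, on each of which [|z ^ n - w|] has exact
    order [s ^ n] for some [s < 1] ([vanishing_near_nonroot]).

    In such a class, if [n < m < l] then [z ^ (m - n)] is at distance about
    [s ^ n] from 1 and [z ^ (l - m)] is much closer.  Two returns to 1 as
    different as these cannot be powers of a common one, and this makes [l] at
    least exponential in [n] ([gap_principle]).  Iterated exponential growth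
    bounds the counting function by every iterated logarithm
    ([exp_gapped_count]). *)


(** * The modulus as a real number *)

Section Modulus.
Variable R : realType.
Implicit Types x y z : R[i].
Local Open Scope complex_scope.

(** The norm of [R[i]] takes its values in [R[i]]; the estimates below live in
    the ordered field [R]. *)
Definition cabs z : R := complex.Re `|z|.

Lemma cabsE z : (cabs z)%:C = `|z|.
Proof. by rewrite RRe_real ?normr_real. Qed.

Lemma cabs_ge0 z : 0 <= cabs z.
Proof. by rewrite -lecR cabsE normr_ge0. Qed.

Lemma cabs0 : cabs 0 = 0.
Proof. by apply: complexI; rewrite cabsE normr0. Qed.

Lemma cabs1 : cabs 1 = 1.
Proof. by apply: complexI; rewrite cabsE normr1. Qed.

Lemma cabsM x y : cabs (x * y) = cabs x * cabs y.
Proof. by apply: complexI; rewrite rmorphM /= !cabsE normrM. Qed.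

Lemma cabsX z n : cabs (z ^+ n) = cabs z ^+ n.
Proof. by apply: complexI; rewrite rmorphXn /= !cabsE normrX. Qed.

Lemma cabsV z : cabs z^-1 = (cabs z)^-1.
Proof. by apply: complexI; rewrite fmorphV /= !cabsE normfV. Qed.

Lemma cabsN z : cabs (- z) = cabs z.
Proof. by apply: complexI; rewrite !cabsE normrN. Qed.

Lemma cabsD x y : cabs (x + y) <= cabs x + cabs y.
Proof. by rewrite -lecR rmorphD /= !cabsE ler_normD. Qed.

Lemma cabsB x y : cabs (x - y) <= cabs x + cabs y.
Proof. by rewrite -(cabsN y) cabsD. Qed.

Lemma cabs_dist x y : cabs x - cabs y <= cabs (x - y).
Proof. by have := cabsD (x - y) y; rewrite subrK; lra. Qed.

Lemma cabs_distC x y : cabs (x - y) = cabs (y - x).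
Proof. by rewrite -cabsN opprB. Qed.

Lemma cabs_eq0 z : (cabs z == 0) = (z == 0).
Proof. by rewrite -(inj_eq (@complexI R)) cabsE normr_eq0. Qed.

Lemma cabs_gt0 z : (0 < cabs z) = (z != 0).
Proof. by rewrite lt_def cabs_ge0 andbT cabs_eq0. Qed.

Lemma cabs_sum (I : Type) (s : seq I) (P : pred I) (F : I -> R[i]) :
  cabs (\sum_(i <- s | P i) F i) <= \sum_(i <- s | P i) cabs (F i).
Proof.
elim/big_ind2: _ => [|x a y b xa yb|//]; first by rewrite cabs0.
by apply: le_trans (cabsD _ _) _; apply: lerD.
Qed.

Lemma cabs_prod (I : Type) (s : seq I) (F : I -> R[i]) :
  cabs (\prod_(i <- s) F i) = \prod_(i <- s) cabs (F i).
Proof. by elim/big_rec2: _ => [|i a b _ <-]; rewrite ?cabs1 ?cabsM. Qed.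

Lemma cabs_lt1 z : `|z| < 1 -> cabs z < 1.
Proof. by rewrite -cabsE -(rmorph1 (real_complex R)) ltcR. Qed.

End Modulus.

(** * Sets of natural numbers with exponential gaps *)

(** An upper bound for a cardinality, meaningful without finiteness being
    established beforehand. *)
Definition at_most (k : nat) (A : set nat) : Prop :=
  forall s : seq nat, uniq s -> (forall n, n \in s -> A n) -> (size s <= k)%N.

Lemma at_mostS k (A B : set nat) : A `<=` B -> at_most k B -> at_most k A.
Proof. by move=> AB Bk s us sA; apply: Bk => // n /sA/AB. Qed.

Lemma at_mostU k l (A B : set nat) :
  at_most k A -> at_most l B -> at_most (k + l) (A `|` B).
Proof.
move=> Ak Bl s us sAB; pose a := [pred n | `[< A n >]].
have := count_predC a s; rewrite -!size_filter => <-.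
apply: leq_add; [apply: Ak|apply: Bl]; rewrite ?filter_uniq//.
  by move=> n; rewrite mem_filter => /andP[/asboolP].
by move=> n; rewrite mem_filter => /andP[/= /asboolP nA /sAB[]].
Qed.

Section ExpGapped.
Variable R : realType.
Implicit Types A B : set nat.

(** A quantitative form of sparsity that, unlike a lower bound on the distance
    between consecutive elements, passes to finite unions. *)
Definition exp_gapped A : Prop := exists (k : nat) (X : R), forall x, X <= x ->
  at_most k (A `&` [set n | x < n%:R <= expR x]).

Lemma exp_gappedS A B : A `<=` B -> exp_gapped B -> exp_gapped A.
Proof.
move=> AB [k [X H]]; exists k, X => x /H; apply: at_mostS.
by move=> n [/AB]; split.
Qed.

Lemma exp_gappedU A B : exp_gapped A -> exp_gapped B -> exp_gapped (A `|` B).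
Proof.
move=> [k [X HA]] [l [Y HB]]; exists (k + l)%N, (Num.max X Y) => x.
rewrite ge_max => /andP[/HA Ak /HB Bl].
by apply: at_mostS (at_mostU Ak Bl) => n [[?|?] ?]; [left|right].
Qed.

Lemma exp_gapped_bounded A (N : nat) :
  (forall n, A n -> (n < N)%N) -> exp_gapped A.
Proof.
move=> AN; exists 0%N, N%:R => x Nx [//|n s _ sA].
have [/AN nN /= /andP[xn _]] := sA n (mem_head _ _).
have nN' : n%:R <= N%:R :> R by rewrite ler_nat ltnW.
by have := lt_le_trans (le_lt_trans Nx xn) nN'; rewrite ltxx.
Qed.

Lemma exp_gapped_tail A (N : nat) :
  exp_gapped (A `&` [set n | (N <= n)%N]) -> exp_gapped A.
Proof.
move=> AN; have NA : exp_gapped [set n | (n < N)%N] by apply: (@exp_gapped_bounded _ N).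
apply: exp_gappedS (exp_gappedU AN NA) => n An.
by have [nN|nN] := leqP N n; [left|right].
Qed.

Lemma exp_gapped_bigU (I : eqType) (s : seq I) (A : I -> set nat) :
  (forall i, i \in s -> exp_gapped (A i)) ->
  exp_gapped [set n | exists2 i, i \in s & A i n].
Proof.
elim: s => [|i s IHs] sA.
  by apply: (@exp_gapped_bounded _ 0) => n [].
have Ai := sA i (mem_head _ _).
have As : exp_gapped [set n | exists2 i, i \in s & A i n].
  by apply: IHs => j js; apply: sA; rewrite inE js orbT.
apply: exp_gappedS (exp_gappedU Ai As) => n [j].
by rewrite inE => /predU1P[->|js]; [left|right; exists j].
Qed.

Lemma iter_ln_large (m : nat) (B : R) :
  exists X, forall x, X <= x -> B <= iter m (@ln R) x.
Proof.
elim: m => [|m [X IHm]]; first by exists B.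
exists (expR X) => x Xx; rewrite iterSr; apply: IHm.
by rewrite -(expRK X) ler_ln ?posrE ?expR_gt0// (lt_le_trans (expR_gt0 _) Xx).
Qed.

(** Every passage from [x] to [ln x] loses boundedly many elements, so the
    counting function is bounded by any iterated logarithm up to a constant. *)
Lemma exp_gapped_count A (m : nat) : exp_gapped A ->
  exists c X : R, forall x, X <= x -> forall s, uniq s ->
    (forall n, n \in s -> A n /\ n%:R <= x) -> (size s)%:R <= c + iter m (@ln R) x.
Proof.
move=> [k [X0 HA]]; elim: m => [|m [c [X IHm]]].
  exists 1, 0 => x x0 s us sA /=.
  have /uniq_leq_size : {subset s <= iota 0 (Num.trunc x).+1}.
    by move=> n /sA[_ nx]; rewrite mem_iota/= add0n ltnS truncn_ge_nat.
  rewrite size_iota -(ler_nat R) => /(_ us)/le_trans; apply.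
  by rewrite -natr1 addrC lerD2l truncn_le.
have [Y HY] := iter_ln_large 1 (Num.max X X0).
exists (c + k%:R), (Num.max Y 1) => x; rewrite ge_max => /andP[/HY].
rewrite /= ge_max => /andP[Xx X0x] x1 s us sA; rewrite -iterS iterSr.
have x0 : 0 < x by rewrite (lt_le_trans ltr01).
pose a := [pred n : nat | n%:R <= ln x].
have := count_predC a s; rewrite -!size_filter => <-; rewrite natrD addrAC.
apply: lerD; first apply: IHm; rewrite ?filter_uniq//.
  by move=> n; rewrite mem_filter => /andP[/= nx /sA[]].
rewrite ler_nat; apply: (HA _ X0x); rewrite ?filter_uniq// => n.
by rewrite mem_filter/= -ltNge lnK ?posrE// => /andP[-> /sA[? ->]].
Qed.

Lemma exp_gapped_very_sparse A : exp_gapped A -> very_sparse R A.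
Proof.
move=> gA m m0; apply/eqoP => e e0.
have [c [X HX]] := exp_gapped_count m.+1 gA.
have [Y HY] := iter_ln_large m (Num.max 1 (2 * (c - ln (e / 2)) / e)).
near=> n.
have Xn : Num.max X Y <= n%:R by near: n; exact: nbhs_infty_ger.
move: Xn; rewrite ge_max => /andP[/HX Xn /HY]; rewrite ge_max.
set y := iter m (@ln R) _ => /andP[y1 yc].
rewrite !ger0_norm; [|lra|exact: ler0n].
have {Xn} : (#|` fset_set (A `&` [set k | (k <= n)%N])|)%:R <= c + ln y.
  apply: Xn; first exact: fset_uniq.
  have fA : finite_set (A `&` [set k | (k <= n)%N]).
    apply: finite_setIr; exact: (sub_finite_set _ (finite_II n.+1)).
  move=> k kA; have : k \in fset_set (A `&` [set k | (k <= n)%N]) by [].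
  by rewrite in_fset_set// inE => -[? /= kn]; rewrite ler_nat.
move=> /le_trans; apply.
have e20 : 0 < e / 2 by lra.
have : ln (1 + (e / 2 * y - 1)) <= e / 2 * y - 1.
  by apply: le_ln1Dx; nra.
rewrite addrCA subrr addr0 lnM ?posrE//; [|lra].
move: yc; rewrite ler_pdivrMr// => yc ?.
lra.
Unshelve. all: by end_near.
Qed.

End ExpGapped.

(** * Unconditionally convergent families of complex numbers *)

(** Stated over a [numFieldType] because the topology of [R[i]] is the one that
    it gets as such a structure. *)
Lemma partial_sum_near (K : numFieldType) (I : choiceType) (x : I -> K) :
  cvg (partial_sum x @ totally) -> forall e, 0 < e ->
  exists J0 : {fset I}, forall J : {fset I}, (J0 `<=` J)%fset ->
    `|lim (partial_sum x @ totally) - \sum_(i <- J) x i| <= e.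
Proof.
have tF := @totally_filter I.
move=> /cvgrPdist_le cx e /cx [J0 _ HJ0]; exists J0 => J /HJ0 /=.
by rewrite /partial_sum big_seq_fsetE.
Qed.

Section Summation.
Variables (R : realType) (I : choiceType).
Implicit Types (x : I -> R[i]) (l : R[i]) (F J : {fset I}).
Local Open Scope complex_scope.

Definition has_sum x l : Prop := forall e : R, 0 < e ->
  exists J0, forall J, (J0 `<=` J)%fset -> cabs (l - \sum_(i <- J) x i) <= e.

Lemma fdisjoint_setD F J : [disjoint F & J `\` F]%fset.
Proof. by rewrite fdisjoint_sym; apply/fdisjointP => i; rewrite inE => /andP[]. Qed.

Lemma sum_fsetU F J (V : nmodType) (x : I -> V) : [disjoint F & J]%fset ->
  \sum_(i <- (F `|` J)%fset) x i = \sum_(i <- F) x i + \sum_(i <- J) x i.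
Proof.
move=> FJ; rewrite -big_cat /=; apply/perm_big/uniq_perm; rewrite ?fset_uniq//.
  rewrite cat_uniq !fset_uniq/= andbT; apply/hasPn => i iJ.
  by move: FJ; rewrite fdisjoint_sym => /fdisjointP/(_ i iJ).
by move=> i; rewrite mem_cat inE.
Qed.

Lemma sum_abs_Re_le x J (B : R) :
  (forall K, (K `<=` J)%fset -> cabs (\sum_(i <- K) x i) <= B) ->
  \sum_(i <- J) `|complex.Re (x i)| <= B *+ 2.
Proof.
move=> xB; pose P := [pred i | 0 <= complex.Re (x i)].
have ReB (Q : pred I) : `|\sum_(i <- J | Q i) complex.Re (x i)| <= B.
  have := xB [fset i in J | Q i]%fset (fset_sub _ _).
  rewrite -lecR cabsE => /(le_trans (normc_ge_Re _)); rewrite lecR.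
  rewrite (big_morph (@complex.Re R) (id1 := 0) (op1 := +%R)) -?big_fset_condE//.
  by case=> a b [].
rewrite (bigID P) /= mulr2n; apply: lerD.
  rewrite (eq_bigr (fun i => complex.Re (x i))) => [|i i0]; last exact: ger0_norm.
  exact: le_trans (ler_norm _) (ReB P).
rewrite (eq_bigr (fun i => - complex.Re (x i))) => [|i]; last first.
  by rewrite -ltNge => i0; rewrite ltr0_norm.
rewrite sumrN; apply: le_trans (ler_norm _) _; rewrite normrN; exact: ReB.
Qed.

Lemma cabs_le_ReIm (z : R[i]) :
  cabs z <= `|complex.Re z| + `|complex.Re (- 'i * z)|.
Proof.
have -> : complex.Re (- 'i * z) = complex.Im z.
  by rewrite mulNr raddfN /= mulrC ReiNIm opprK.
rewrite /cabs normc_def /= -[leRHS]ger0_norm ?addr_ge0// -sqrtr_sqr.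
rewrite ler_sqrt ?sqr_ge0// sqrrD !real_normK ?num_real//.
by rewrite addrAC lerDl mulrn_wge0// mulr_ge0.
Qed.

(** The finite subsums that avoid a large finite set are bounded, hence so are
    those of the positive and negative parts of the real and imaginary
    parts. *)
Lemma sum_cabs_bounded x l : has_sum x l ->
  exists W : R, forall J, \sum_(i <- J) cabs (x i) <= W.
Proof.
move=> /(_ 1 ltr01) [J0 HJ0].
have xB K : [disjoint J0 & K]%fset -> cabs (\sum_(i <- K) x i) <= 2.
  move=> J0K; have := HJ0 (J0 `|` K)%fset (fsubsetUl _ _).
  have := HJ0 J0 (fsubset_refl _); rewrite sum_fsetU//.
  set s0 := \sum_(_ <- J0) _; set s := \sum_(_ <- K) _ => h1 h2.
  have -> : s = (l - s0) - (l - (s0 + s)) by ring.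
  by apply: le_trans (cabsB _ _) _; lra.
exists (8 + \sum_(i <- J0) cabs (x i)) => J.
have JE : \sum_(i <- J) cabs (x i) <= \sum_(i <- (J0 `|` (J `\` J0))%fset) cabs (x i).
  rewrite -{1}(fsetID J0 J) !sum_fsetU ?fdisjoint_setD//; last first.
    exact: fdisjointWl (fsubsetIr _ _) (fdisjoint_setD _ _).
  rewrite lerD2r -{2}(fsetID J J0) sum_fsetU; last first.
    exact: fdisjointWl (fsubsetIr _ _) (fdisjoint_setD _ _).
  by rewrite fsetIC lerDl sumr_ge0// => i _; exact: cabs_ge0.
rewrite (le_trans JE)// sum_fsetU ?fdisjoint_setD//.
rewrite addrC lerD2r.
have KB K : (K `<=` J `\` J0)%fset -> [disjoint J0 & K]%fset.
  move=> /fsubsetP KJ; rewrite fdisjoint_sym; apply/fdisjointP => i /KJ.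
  by rewrite inE => /andP[].
have ReB := @sum_abs_Re_le x (J `\` J0)%fset 2 (fun K hK => xB K (KB K hK)).
have ImB : \sum_(i <- (J `\` J0)%fset) `|complex.Re (- 'i * x i)| <= 2 *+ 2.
  apply: sum_abs_Re_le => K /KB/xB.
  rewrite -mulr_sumr cabsM; suff -> : cabs (- 'i : R[i]) = 1 by rewrite mul1r.
  by apply/eqP; rewrite -sqrp_eq1 ?cabs_ge0// -cabsX sqrrN sqr_i cabsN cabs1.
apply: le_trans (ler_sum _ (fun i _ => cabs_le_ReIm (x i))) _.
by rewrite big_split /=; lra.
Qed.

Lemma has_sum_tail x l F (B : R) : has_sum x l ->
  (forall J, [disjoint F & J]%fset -> cabs (\sum_(i <- J) x i) <= B) ->
  cabs (l - \sum_(i <- F) x i) <= B.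
Proof.
move=> cx xB.
apply/ler_addgt0Pr => e /cx [J0 /(_ _ (fsubsetUl _ F))].
have FJ := fdisjoint_setD F J0.
have -> : (J0 `|` F = F `|` (J0 `\` F))%fset.
  by apply/fsetP => i; rewrite !inE; case: (i \in F); rewrite ?orbT ?orbF.
rewrite sum_fsetU// => h; have := xB _ FJ.
move: h; set s := \sum_(i <- F) _; set t := \sum_(i <- _) _ => h1 h2.
have -> : l - s = (l - (s + t)) + t by ring.
by apply: le_trans (cabsD _ _) _; rewrite addrC lerD.
Qed.

End Summation.

Lemma has_sum_ps2 (R : realType) (f : nat -> nat -> R[i]) (z : R[i] * R[i]) :
  ps2_cvg f z -> has_sum (ps2_term f z) (ps2_eval f z).
Proof.
move=> /partial_sum_near cf e e0.
have /cf [J0 HJ0] : 0 < e%:C%C :> R[i] by rewrite ltcR.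
by exists J0 => J /HJ0; rewrite -cabsE lecR.
Qed.

(** * Sums of exponentials *)

Lemma exprn_large (R : realType) (g K : R) :
  1 < g -> exists N, forall n, (N <= n)%N -> K < g ^+ n.
Proof.
move=> g1; have bern n : n%:R * (g - 1) <= g ^+ n.
  elim: n => [|n IHn]; first by rewrite mul0r.
  have := exprn_ege1 n (ltW g1); rewrite exprS -natr1; nra.
exists (Num.trunc (K / (g - 1))).+1 => n nN.
apply: lt_le_trans (bern n); rewrite -ltr_pdivrMr ?subr_gt0//.
by apply: lt_le_trans (truncnS_gt _) _; rewrite ler_nat.
Qed.

Lemma exprn_small (R : realType) (s K e : R) : 0 <= s < 1 -> 0 < e ->
  exists N, forall n, (N <= n)%N -> K * s ^+ n < e.
Proof.
move=> /andP[]; rewrite le_eqVlt => /predU1P[<- _|s0 s1] e0.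
  by exists 1%N => -[//|n] _; rewrite expr0n mulr0.
have s1' : 1 < s^-1 by rewrite invf_gt1.
have [N HN] := exprn_large (K / e) s1'.
exists N => n /HN; rewrite exprVn ltr_pdivrMr// mulrC.
by rewrite ltr_pdivlMr ?exprn_gt0.
Qed.

Section ExponentialSums.
Variables (R : realType) (I : choiceType) (c v : I -> R[i]).
Variables (g : nat -> R[i]) (M : nat).
Hypothesis gE : forall n, (M <= n)%N ->
  has_sum (fun i => c i * v i ^+ n) (g n).

Lemma exp_sum_bounded : exists W : R, 0 <= W /\
  forall J : {fset I}, \sum_(i <- J) cabs (c i) * cabs (v i) ^+ M <= W.
Proof.
have [W HW] := sum_cabs_bounded (gE (leqnn M)).
exists W; split; first by have := HW fset0; rewrite big_seq_fset0.
by move=> J; under eq_bigr do rewrite -cabsX -cabsM; exact: HW.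
Qed.

(** Absolute convergence at the single exponent [M] controls all later tails:
    each further step multiplies a term with [|v i| <= t] by at most [t]. *)
Lemma exp_sum_tail (W t : R) (F : {fset I}) (n : nat) :
  (forall J : {fset I}, \sum_(i <- J) cabs (c i) * cabs (v i) ^+ M <= W) ->
  0 <= t -> (forall i, i \notin F -> cabs (v i) <= t) -> (M <= n)%N ->
  cabs (g n - \sum_(i <- F) c i * v i ^+ n) <= t ^+ (n - M) * W.
Proof.
move=> HW t0 Ft Mn; apply: has_sum_tail (gE Mn) _ => J FJ.
apply: le_trans (cabs_sum _ _ _) _.
apply: le_trans (ler_wpM2l (exprn_ge0 _ t0) (HW J)); rewrite mulr_sumr.
rewrite big_seq [leRHS]big_seq; apply: ler_sum => i iJ.
rewrite cabsM cabsX -{1}(subnK Mn) exprD mulrCA mulrA.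
have /Ft vt : i \notin F.
  by apply: contraL iJ => iF; move/fdisjointP: FJ; exact.
rewrite -!mulrA ler_wpM2r ?mulr_ge0 ?exprn_ge0 ?cabs_ge0//.
by rewrite lerXn2r ?nnegrE ?cabs_ge0.
Qed.

Hypothesis levels : forall t : R, 0 < t ->
  exists F : {fset I}, forall i, (i \in F) = (t < cabs (v i)).

Section Progression.
Variables N r : nat.
Hypothesis vN : forall i j, 0 < cabs (v i) -> cabs (v i) = cabs (v j) ->
  v i ^+ N = v j ^+ N.

Let S (F : {fset I}) n := \sum_(i <- F) c i * v i ^+ n.

(** Take the truncation [S F] with the fewest terms that does not vanish on the
    whole class.  Its terms of modulus above the least one, [m], form a
    truncation that vanishes, so it reduces to its terms of modulus [m].  By
    [vN] these are multiplied by a common factor when [n] grows by [N], hence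
    dominate the tail, whose terms have modulus at most [t < m]. *)
Lemma exp_sum_dominant (t : R) (F : {fset I}) (n0 : nat) :
  0 < t -> (forall i, (i \in F) = (t < cabs (v i))) ->
  n0 = r %[mod N] -> (M < n0)%N -> S F n0 != 0 ->
  exists B, forall n, n = r %[mod N] -> (M <= n)%N -> g n = 0 -> (n < B)%N.
Proof.
have [k] := ubnP #|` F|; elim: k => // k IHk in t F n0 *.
rewrite ltnS => Fk t0 Ft n0r Mn0 SF0.
have [F0|[j0 j0F]] := fset_0Vmem F.
  by move: SF0; rewrite /S F0 big_seq_fset0 eqxx.
have [[i0 i0F] _ i0min] := @Order.TotalTheory.arg_minP _ _ F [` j0F]%fset predT
  (fun i => cabs (v (val i))) isT.
pose m := cabs (v i0); have tm : t < m by rewrite -Ft.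
have m0 := lt_trans t0 tm.
have [F' F'm] := levels m0.
have F'F : (F' `<=` F)%fset.
  by apply/fsubsetP => i; rewrite F'm Ft; exact: lt_trans.
have F'k : (#|` F'| < k)%N.
  apply: leq_trans Fk; apply: fproper_ltn_card; rewrite fproperEneq F'F andbT.
  by apply/eqP => F'E; move: (F'm i0); rewrite F'E i0F ltxx.
have [[n1 [n1r Mn1 S1]]|S'0] := pselect (exists n1,
    [/\ n1 = r %[mod N], (M < n1)%N & S F' n1 != 0]).
  exact: (IHk m F' n1).
have {}S'0 n : n = r %[mod N] -> (M < n)%N -> S F' n = 0.
  by move=> nr Mn; apply: contra_notP S'0 => /eqP; exists n.
have SE n : n = r %[mod N] -> (M < n)%N -> S F n = S (F `\` F')%fset n.
  move=> nr Mn; rewrite -[LHS]/(\sum_(i <- F) _) -{1}(fsetID F' F).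
  rewrite (fsetIidPr F'F) sum_fsetU ?fdisjoint_setD//.
  by have := S'0 n nr Mn; rewrite /S => ->; rewrite add0r.
have vm i : i \in (F `\` F')%fset -> cabs (v i) = m.
  rewrite inE F'm -leNgt => /andP[im iF]; apply/le_anti; rewrite im /=.
  exact: (i0min [` iF]%fset).
have [W [W0 HW]] := exp_sum_bounded.
have A0 : 0 < cabs (S F n0) by rewrite cabs_gt0.
have mt1 : 1 < m / t by rewrite ltr_pdivlMr ?mul1r.
have [B HB] := exprn_large (t ^+ (n0 - M) * W / cabs (S F n0)) mt1.
exists (n0 + B)%N => n nr Mn gn0; rewrite ltnNge; apply/negP => nB.
have n0n : (n0 <= n)%N by exact: leq_trans (leq_addr _ _) nB.
have [q nE] : exists q, n = (n0 + N * q)%N.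
  have : (N %| n - n0)%N by rewrite -eqn_mod_dvd// n0r nr.
  by move=> /dvdnP[q qE]; exists q; rewrite mulnC -qE subnKC.
have SnE : cabs (S F n) = m ^+ (n - n0) * cabs (S F n0).
  rewrite !SE// ?(leq_trans Mn0)// -[m]/(cabs (v i0)) -cabsX -cabsM; congr cabs.
  rewrite /S mulr_sumr; apply: eq_big_seq => i iF.
  rewrite nE addKn exprD !exprM (vN (j := i0)) ?(vm i iF)//.
  by rewrite mulrA mulrC.
have := exp_sum_tail HW (ltW t0) _ Mn; move=> /(_ F) /=.
rewrite gn0 sub0r cabsN -/(S F n) SnE => H.
have {}H : m ^+ (n - n0) * cabs (S F n0) <= t ^+ (n - M) * W.
  by apply: H => i; rewrite Ft leNgt.
have := HB (n - n0)%N; rewrite leq_subRL// => /(_ nB).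
rewrite ltr_pdivrMr// expr_div_n mulrAC ltr_pdivlMr ?exprn_gt0//.
rewrite ltNge; apply/negP; rewrite negbK (le_trans H)//.
rewrite mulrAC -exprD addnC.
by rewrite addnBA ?(ltnW Mn0)// subnK.
Qed.

(** If no truncation is nonzero on the class, letting the threshold tend to 0
    shows that the full sum vanishes there. *)
Lemma exp_sum_progression :
  (forall n, n = r %[mod N] -> (M < n)%N -> g n = 0) \/
  exists B, forall n, n = r %[mod N] -> (M <= n)%N -> g n = 0 -> (n < B)%N.
Proof.
have [[t [F [n0 [t0 Ft n0r Mn0 S0]]]]|S0] := pselect (exists t F n0,
    [/\ 0 < t, forall i, (i \in F) = (t < cabs (v i)), n0 = r %[mod N],
     (M < n0)%N & S F n0 != 0]).
  by right; exact: (exp_sum_dominant t0 Ft n0r).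
left => n nr Mn; apply/eqP; rewrite -cabs_eq0 eq_le cabs_ge0 andbT.
have [W [W0 HW]] := exp_sum_bounded.
apply/ler_addgt0Pr => e e0; rewrite add0r.
have W1 : 0 < W + 1 by rewrite ltr_wpDl.
pose t := Num.min 1 (e / (W + 1)).
have t0 : 0 < t by rewrite lt_min ltr01 divr_gt0.
have [F Ft] := levels t0.
have := exp_sum_tail HW (ltW t0) _ (ltnW Mn); move=> /(_ F) /=.
have -> : \sum_(i <- F) c i * v i ^+ n = 0.
  by apply: contra_notP S0 => /eqP SF; exists t, F, n.
rewrite subr0 => H; apply: le_trans (H _) _ => [i|]; first by rewrite Ft leNgt.
have -> : (n - M)%N = (n - M).-1.+1 by rewrite prednK// subn_gt0.
rewrite exprS -mulrA.
have tW : t * W <= e.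
  have : t <= e / (W + 1) by rewrite ge_min lexx orbT.
  rewrite ler_pdivlMr//; nra.
have t1 : t ^+ (n - M).-1 <= 1 by rewrite exprn_ile1 ?(ltW t0)// ge_min lexx.
by rewrite mulrCA; have := exprn_ge0 (n - M).-1 (ltW t0); nra.
Qed.

End Progression.
End ExponentialSums.

(** * The gap principle on the unit circle *)

Section GapPrinciple.
Variable R : realType.
Implicit Types (s C g : R) (A : set nat).

(** The bound is [1 + s + ... + s ^ n <= 1 / (1 - s)], whose terms are all at
    least [s ^ n]. *)
Lemma mulrn_exprn_le1 s n : 0 <= s <= 1 -> n%:R * (1 - s) * s ^+ n <= 1.
Proof.
move=> /andP[s0 s1]; suff : n%:R * (1 - s) * s ^+ n <= 1 - s ^+ n.
  by have := exprn_ge0 n s0; lra.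
elim: n => [|n IHn]; first by rewrite !mul0r expr0 subrr.
have := exprn_ge0 n s0; have := exprn_ile1 n.+1 s0 s1.
rewrite -natr1 exprS; set p := s ^+ n in IHn *; set q := n%:R in IHn *.
nra.
Qed.

Lemma mulrn_exprn_small s e : 0 < s < 1 -> 0 < e ->
  exists N, forall n, (N <= n)%N -> n%:R * s ^+ n < e.
Proof.
move=> /andP[s0 s1] e0; pose t := Num.sqrt s.
have t0 : 0 < t by rewrite sqrtr_gt0.
have t1 : t < 1 by rewrite -sqrtr1 ltr_sqrt.
have t01 : 0 <= t < 1 by rewrite ltW.
have et : 0 < e * (1 - t) by rewrite mulr_gt0// subr_gt0.
have [N HN] := exprn_small 1 t01 et.
exists N => n /HN; rewrite mul1r => h.
have t01' : 0 <= t <= 1 by rewrite !ltW.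
have h1 := mulrn_exprn_le1 n t01'.
have -> : s ^+ n = t ^+ n * t ^+ n by rewrite -exprMn -expr2 sqr_sqrtr// ltW.
have tn0 := exprn_gt0 n t0.
rewrite -(ltr_pM2r (_ : 0 < 1 - t)) ?subr_gt0//.
set p := t ^+ n in h h1 tn0 *; set q := n%:R in h1 *.
have -> : q * (p * p) * (1 - t) = (q * (1 - t) * p) * p by ring.
nra.
Qed.

(** Two applications of the hypothesis iterate the exponential of base [g],
    which beats the natural exponential. *)
Lemma exp_gapped_triples A C g (N0 : nat) : 0 < C -> 1 < g ->
  (forall n m l, A n -> A m -> A l -> (N0 <= n < m)%N -> (m < l)%N ->
    C * g ^+ n <= l%:R) -> exp_gapped R A.
Proof.
move=> C0 g1 HA; have g0 : 0 < g := lt_trans ltr01 g1.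
(* Once [C * g ^ n >= K * n + K'], one has [C * g ^ (C * g ^ n) >= exp n]. *)
have [K HK] := exprn_large (expR 1) g1.
have [K' HK'] := exprn_large C^-1 g1.
have s01 : 0 < g^-1 < 1 by rewrite invr_gt0 g0 invf_lt1.
have e0 : 0 < C / (K + K').+1%:R by rewrite divr_gt0.
have [N1 HN1] := mulrn_exprn_small s01 e0.
exists 4%N, (maxn (maxn N0 N1) 1)%:R => x Nx s us sA.
rewrite leqNgt; apply/negP => s5.
have : sorted ltn (sort leq s).
  by rewrite ltn_sorted_uniq_leq sort_uniq us sort_sorted//; exact: leq_total.
have {}sA n : n \in sort leq s -> A n /\ x < n%:R <= expR x.
  by rewrite mem_sort => /sA[].
have : (4 < size (sort leq s))%N by rewrite size_sort.
case: (sort leq s) sA => [|n1 [|n2 [|n3 [|n4 [|n5 s']]]]] //= sA _.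
move=> /and5P[n12 n23 n34 n45 _].
have [A1 /andP[x1 _]] := sA n1 ltac:(by rewrite !inE eqxx).
have [A2 _] := sA n2 ltac:(by rewrite !inE eqxx ?orbT).
have [A3 _] := sA n3 ltac:(by rewrite !inE eqxx ?orbT).
have [A4 _] := sA n4 ltac:(by rewrite !inE eqxx ?orbT).
have [A5 /andP[_ x5]] := sA n5 ltac:(by rewrite !inE eqxx ?orbT).
have : (maxn (maxn N0 N1) 1 < n1)%N by rewrite -(ltr_nat R) (le_lt_trans Nx).
rewrite !gtn_max -andbA => /and3P[N0n N1n n1n].
have N0n12 : (N0 <= n1 < n2)%N by rewrite (ltnW N0n).
have N0n34 : (N0 <= n3 < n4)%N.
  by rewrite n34 andbT (leq_trans (ltnW N0n))// ltnW// (ltn_trans n12).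
have h3 := HA n1 n2 n3 A1 A2 A3 N0n12 n23.
have h5 := HA n3 n4 n5 A3 A4 A5 N0n34 n45.
have n3K : (K * n1 + K' <= n3)%N.
  rewrite -(ler_nat R) (le_trans _ h3)//.
  have := HN1 n1 (ltnW N1n); rewrite exprVn ltr_pdivrMr ?exprn_gt0//.
  rewrite mulrAC ltr_pdivlMr ?ltr0n// => /ltW h; apply: le_trans h.
  rewrite -natrM ler_nat mulnS mulnDr mulnC (leq_trans _ (leq_addl _ _))//.
  by rewrite leq_add2l leq_pmull// ltnW.
have /ltW hK := HK K (leqnn _); have /ltW hK' := HK' K' (leqnn _).
have : expR n1%:R <= C * g ^+ n3.
  apply: (@le_trans _ _ (C * g ^+ (K * n1 + K'))); last first.
    by rewrite ler_wpM2l ?(ltW C0)// ler_weXn2l// ltW.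
  rewrite exprD exprM mulrCA -[n1%:R]mulr1 expRM_natl.
  rewrite -[leLHS]mulr1 ler_pM ?exprn_ge0 ?expR_ge0//.
    by rewrite lerXn2r ?nnegrE ?expR_ge0 ?exprn_ge0 ?(ltW g0).
  by rewrite -(mulfV (lt0r_neq0 C0)) ler_wpM2l// ltW.
have : expR x < expR n1%:R by rewrite ltr_expR.
lra.
Qed.

Lemma cabs_expr_sub1_le (u : R[i]) k : cabs u = 1 ->
  cabs (u ^+ k - 1) <= k%:R * cabs (u - 1).
Proof.
move=> u1; elim: k => [|k IHk]; first by rewrite expr0 subrr cabs0 mul0r.
have -> : u ^+ k.+1 - 1 = u * (u ^+ k - 1) + (u - 1) by rewrite exprS; ring.
by apply: le_trans (cabsD _ _) _; rewrite cabsM u1 mul1r -natr1 mulrDl mul1r lerD2r.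
Qed.

(** While [k * |u - 1|] stays below 1, the error of the linear approximation
    [u ^ k - 1 ~ k * (u - 1)] is at most half of its main term. *)
Lemma cabs_expr_sub1_ge (u : R[i]) k : cabs u = 1 -> k%:R * cabs (u - 1) <= 1 ->
  k%:R * cabs (u - 1) <= 2 * cabs (u ^+ k - 1).
Proof.
move=> u1; set e := cabs (u - 1) => ke.
have H j : cabs (u ^+ j - 1 - j%:R * (u - 1)) <= (j%:R * e) ^+ 2 / 2.
  elim: j => [|j IHj].
    by rewrite expr0 !mul0r !subrr cabs0 expr0n mul0r.
  have -> : u ^+ j.+1 - 1 - j.+1%:R * (u - 1) =
    (u ^+ j - 1 - j%:R * (u - 1)) + (u ^+ j - 1) * (u - 1).
    by rewrite exprS -natr1; ring.
  apply: le_trans (cabsD _ _) _; rewrite cabsM -/e.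
  have := cabs_expr_sub1_le j u1; rewrite -/e -natr1.
  have : 0 <= e by exact: cabs_ge0.
  set q := j%:R in IHj *; set a := cabs (u ^+ j - 1).
  set b := cabs _ in IHj *; nra.
have := H k; have := cabs_dist (k%:R * (u - 1)) (u ^+ k - 1).
rewrite cabs_distC cabsM -/e.
have -> : cabs (k%:R : R[i]) = k%:R.
  by apply: complexI; rewrite cabsE normr_nat rmorph_nat.
have : 0 <= k%:R * e by rewrite mulr_ge0 ?cabs_ge0.
by set p := k%:R * e in ke *; nra.
Qed.

Variable z : R[i].
Hypotheses (z1 : cabs z = 1) (z_nontorsion : forall k, (0 < k)%N -> z ^+ k != 1).

Lemma cabs_expr_sub1_bound (d0 : nat) :
  exists2 e : R, 0 < e & forall d, (0 < d < d0)%N -> e <= cabs (z ^+ d - 1).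
Proof.
elim: d0 => [|d0 [e e0 IHd]]; first by exists 1 => // d; rewrite ltn0 andbF.
have [->|d0_gt0] := posnP d0; first by exists 1 => // -[|[|d]].
exists (Num.min e (cabs (z ^+ d0 - 1))) => [|d].
  by rewrite lt_min e0 cabs_gt0 subr_eq0 z_nontorsion.
rewrite ltnS => /andP[d_gt0]; rewrite leq_eqVlt => /predU1P[->|dd0].
  by rewrite ge_min lexx orbT.
by rewrite ge_min IHd ?d_gt0.
Qed.

(** For [n < m < l] put [u = z ^ (m - n)] and [v = z ^ (l - m)].  The hypothesis
    makes the distance of [u] to 1 comparable to [s ^ n] for large [n], and that
    of [v] at most a multiple of [s ^ m], which is much smaller.  If [l - m] were
    at most the inverse of the former distance, the equality
    [u ^ (l - m) = v ^ (m - n)] would contradict this disparity; hence [l] is at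
    least exponential in [n]. *)
Lemma gap_principle (w : R[i]) (A : set nat) (c1 c2 s : R) :
  0 < c1 -> 0 < c2 -> 0 < s < 1 ->
  (forall n, A n -> c1 * s ^+ n <= cabs (z ^+ n - w) <= c2 * s ^+ n) ->
  exp_gapped R A.
Proof.
move=> c10 c20 s01 HA; have /andP[s0 s1] := s01.
(* [d0] makes [m - n >= d0] incompatible with a small [l - m], and [N0] forces
   [m - n >= d0], since the powers [z ^ d] with [0 < d < d0] stay away from 1. *)
have c0 : 0 < c1 / (8 * c2) by rewrite divr_gt0// mulr_gt0.
have [d0 Hd0] := mulrn_exprn_small s01 c0.
have [e e0 He] := cabs_expr_sub1_bound d0.
have s01' : 0 <= s < 1 by rewrite ltW.
have [N0 HN0] := exprn_small (2 * c2) s01' e0.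
apply: (@exp_gapped_triples A (2 * c2)^-1 s^-1 N0).
- by rewrite invr_gt0 mulr_gt0.
- by rewrite invf_gt1.
move=> n m l An Am Al /andP[N0n nm] ml.
have shift i j : (i < j)%N -> cabs (z ^+ (j - i) - 1) = cabs (z ^+ j - z ^+ i).
  move=> ij; rewrite -{2}(subnK (ltnW ij)) exprD -{2}[z ^+ i]mul1r -mulrBl.
  by rewrite cabsM cabsX z1 expr1n mulr1.
have dist i j : A i -> A j -> (i < j)%N ->
    c1 * s ^+ i - c2 * s ^+ j <= cabs (z ^+ (j - i) - 1) <= 2 * c2 * s ^+ i.
  move=> /HA/andP[i1 i2] /HA/andP[j1 j2] ij; rewrite shift//.
  have sij : s ^+ j <= s ^+ i by rewrite ler_wiXn2l ?(ltW s0) ?(ltW s1) ?(ltnW ij).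
  have tele x y : x - w - (y - w) = x - y by ring.
  have := cabsB (z ^+ j - w) (z ^+ i - w); rewrite tele.
  have := cabs_dist (z ^+ i - w) (z ^+ j - w).
  rewrite tele (cabs_distC (z ^+ i) (z ^+ j)).
  have : c2 * s ^+ j <= c2 * s ^+ i by rewrite ler_pM2l.
  by move=> h0 h1 h2; apply/andP; split; lra.
have /andP[nm1 nm2] := dist n m An Am nm.
have /andP[_ ml2] := dist m l Am Al ml.
have d0d : (d0 <= m - n)%N.
  rewrite leqNgt; apply/negP => dd0.
  have := He (m - n)%N; rewrite subn_gt0 nm dd0 => /(_ isT).
  by have := HN0 n N0n; lra.
have := Hd0 _ d0d; rewrite ltr_pdivlMr ?mulr_gt0// => hd.
have mE : s ^+ m = s ^+ (m - n) * s ^+ n by rewrite -exprD subnK// ltnW.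
rewrite mE in nm1 ml2.
move: nm1 nm2 ml2 hd; set d := (m - n)%N; set d' := (l - m)%N.
set eta := cabs _; set eta' := cabs _; set p := s ^+ d; set q := s ^+ n.
move=> nm1 nm2 ml2 hd.
have q0 : 0 < q by rewrite exprn_gt0.
have p0 : 0 < p by rewrite exprn_gt0.
have d1 : 1 <= d%:R :> R by rewrite ler1n subn_gt0.
have d'1 : 1 <= d'%:R :> R by rewrite ler1n subn_gt0.
have zu k : cabs (z ^+ k) = 1 by rewrite cabsX z1 expr1n.
have d'eta : 1 < d'%:R * eta.
  rewrite ltNge; apply/negP => le1.
  have := cabs_expr_sub1_ge (zu d) le1.
  rewrite -exprM mulnC exprM -/eta.
  have := cabs_expr_sub1_le d (zu d'); rewrite -/eta' => h1 h2.
  have eta1 : c1 / 2 * q <= eta.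
    have : c2 * p <= c1 / 2 by nra.
    nra.
  have eta0 : 0 <= eta by exact: cabs_ge0.
  have h3 : eta <= d'%:R * eta by rewrite ler_peMl.
  have : d%:R * eta' <= d%:R * p * (2 * c2) * q by rewrite -!mulrA ler_wpM2l //; nra.
  nra.
have : d'%:R <= l%:R :> R by rewrite ler_nat leq_subr.
apply: le_trans; rewrite exprVn -/q -invfM -[leLHS]mul1r ler_pdivrMr ?mulr_gt0//.
nra.
Qed.

End GapPrinciple.

(** * Monomial comparisons *)

Section MonomialPairs.
Variable R : realType.
Variables (r : R) (z w : R[i]).
Hypotheses (r0 : 0 < r) (r1 : r < 1) (z1 : cabs z = 1)
  (z_nontorsion : forall k, (0 < k)%N -> z ^+ k != 1).

Let t n : R := cabs (z ^+ n - w).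

Lemma exists_rootn (x : R) (n : nat) : 0 < x -> (0 < n)%N ->
  exists2 y : R, 0 < y & y ^+ n = x.
Proof.
move=> x0 n0; exists (x `^ n%:R^-1); first exact: powR_gt0.
by rewrite -powR_mulrn ?powR_ge0// -powRrM mulVf ?pnatr_eq0 -?lt0n// powRr1// ltW.
Qed.

Lemma exp_gapped_small (A : set nat) (c K : R) (m : nat) :
  0 < c -> (0 < m)%N -> (forall n, A n -> c <= K * r ^+ (n * m)) ->
  exp_gapped R A.
Proof.
move=> c0 m0 HA; have r01 : 0 <= r ^+ m < 1.
  by rewrite exprn_ge0 ?(ltW r0)//= exprn_ilt1// ?ltW// -lt0n.
have [N HN] := exprn_small K r01 c0.
apply: (@exp_gapped_bounded _ _ N) => n An; rewrite ltnNge; apply/negP => /HN.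
by rewrite -exprM mulnC ltNge HA.
Qed.

(** Taking [b]-th roots reduces the two-sided bound on [t n ^ b] to one on
    [t n] itself. *)
Lemma gap_principle_pow (A : set nat) (c1 c2 : R) (a b : nat) :
  0 < c1 -> 0 < c2 -> (0 < a)%N -> (0 < b)%N ->
  (forall n, A n -> c1 * r ^+ (n * a) <= t n ^+ b <= c2 * r ^+ (n * a)) ->
  exp_gapped R A.
Proof.
move=> c10 c20 a0 b0 HA.
have [d1 d10 d1E] := exists_rootn c10 b0.
have [d2 d20 d2E] := exists_rootn c20 b0.
have [s s0 sE] := exists_rootn (exprn_gt0 a r0) b0.
have s1 : s < 1.
  rewrite ltNge; apply/negP => /(exprn_ege1 b).
  by rewrite sE leNgt exprn_ilt1 ?(ltW r0)// -lt0n a0.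
apply: (@gap_principle R z z1 z_nontorsion w A d1 d2 s) => //; first by rewrite s0.
move=> n /HA; rewrite mulnC exprM -sE -d1E -d2E -exprM mulnC exprM -!exprMn.
by rewrite !ler_pXn2r// ?nnegrE ?cabs_ge0// ?mulr_ge0 ?exprn_ge0// ltW.
Qed.

(** Comparability of two distinct monomials in [r ^ n] and [t n] either bounds [n],
    as [t n] tends to 0, or makes [t n] of exact order a positive real power of
    [r ^ n]. *)
Lemma exp_gapped_comparable (A : set nat) (c c' H C : R) (l k l' k' D : nat) :
  0 < c -> 0 < c' -> 0 < H -> (0 < D)%N -> (k <= k')%N -> (l, k) != (l', k') ->
  (forall n, A n -> [/\ t n ^+ D <= C * r ^+ n,
     0 < c' * (r ^+ (n * l') * t n ^+ k'),
     c * (r ^+ (n * l) * t n ^+ k) <= H * (c' * (r ^+ (n * l') * t n ^+ k')) &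
     c' * (r ^+ (n * l') * t n ^+ k') <= H * (c * (r ^+ (n * l) * t n ^+ k))]) ->
  exp_gapped R A.
Proof.
move=> c0 c'0 H0 D0 kk' ll' HA.
have rn m : 0 < r ^+ m by rewrite exprn_gt0.
have t0 n : 0 <= t n by exact: cabs_ge0.
have red n : A n ->
    c * r ^+ (n * l) <= H * c' * (r ^+ (n * l') * t n ^+ (k' - k)) /\
    c' * (r ^+ (n * l') * t n ^+ (k' - k)) <= H * c * r ^+ (n * l).
  move=> /HA[_]; rewrite -(subnK kk') exprD.
  set x := r ^+ _; set y := r ^+ _; set u := t n ^+ (_ - _); set v := t n ^+ k.
  have v0 : 0 <= v by rewrite exprn_ge0.
  rewrite addnK -/u => p0 h1 h2; have {p0}v1 : 0 < v.
    rewrite lt_def v0 andbT; apply: contraTneq p0 => ->.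
    by rewrite !mulr0 ltxx.
  by split; rewrite -(ler_pM2r v1); nra.
have [kE|kk] := eqVneq k k'.
  move: red; rewrite kE subnn => red; rewrite kE in ll'.
  have [lt_l|lt_l|lE] := ltngtP l l'; last by rewrite lE eqxx in ll'.
  - apply: (@exp_gapped_small A c (H * c') (l' - l)) => // [|n /red[+ _]].
      by rewrite subn_gt0.
    rewrite expr0 mulr1 -{1}(subnK (ltnW lt_l)) mulnDr exprD mulrA.
    by rewrite ler_pM2r.
  - apply: (@exp_gapped_small A c' (H * c) (l - l')) => // [|n /red[_ +]].
      by rewrite subn_gt0.
    rewrite expr0 mulr1 -{1}(subnK (ltnW lt_l)) mulnDr exprD mulrA.
    by rewrite ler_pM2r.
have b0 : (0 < k' - k)%N by rewrite subn_gt0 ltn_neqAle kk.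
move: b0 red; set b := (k' - k)%N => b0 red.
have [le_l|lt_l] := leqP l l'.
  apply: (@exp_gapped_small A ((c / (H * c')) ^+ D) (C ^+ b) b) => //.
    by rewrite exprn_gt0// divr_gt0// mulr_gt0.
  move=> n An; have [tD _ _ _] := HA n An; have [+ _] := red n An.
  rewrite -{1}(subnK le_l) mulnDr exprD [_ * r ^+ (n * l) * _]mulrAC mulrA.
  rewrite ler_pM2r// => h.
  have {}h : c / (H * c') <= t n ^+ b.
    rewrite ler_pdivrMr ?mulr_gt0// mulrC; apply: le_trans h _.
    rewrite ler_pM2l ?mulr_gt0// ler_piMl ?exprn_ge0//.
    by rewrite exprn_ile1// ltW.
  apply: (@le_trans _ _ ((t n ^+ b) ^+ D)).
    by rewrite lerXn2r ?nnegrE ?exprn_ge0// divr_ge0// ltW// mulr_gt0.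
  rewrite -exprM mulnC exprM exprM -exprMn lerXn2r// nnegrE ?exprn_ge0//.
  by apply: le_trans tD; rewrite exprn_ge0.
apply: (@gap_principle_pow A (c / (H * c')) (H * c / c') (l - l') b) => //.
- by rewrite divr_gt0// mulr_gt0.
- by rewrite divr_gt0// mulr_gt0.
- by rewrite subn_gt0.
move=> n /red[].
have -> : r ^+ (n * l) = r ^+ (n * (l - l')) * r ^+ (n * l').
  by rewrite -exprD -mulnDr subnK// ltnW.
set x := r ^+ _; set y := r ^+ _; have y0 : 0 < y by exact: rn.
move=> h1 h2; apply/andP; split.
  rewrite mulrAC ler_pdivrMr ?mulr_gt0// -(ler_pM2r y0); nra.
rewrite [_ / _ * _]mulrAC ler_pdivlMr// -(ler_pM2r y0); nra.
Qed.

(** A sum much smaller than one of its terms has a largest term that must be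
    compensated by another one of comparable size. *)
Lemma comparable_terms (I : finType) (F : I -> R[i]) (i0 : I) :
  2 * cabs (\sum_i F i) < cabs (F i0) ->
  exists i j, [/\ i != j, F i != 0, F j != 0,
    cabs (F i) <= (2 * #|I|%:R) * cabs (F j) &
    cabs (F j) <= (2 * #|I|%:R) * cabs (F i)].
Proof.
move=> F0.
have [i _ imax] := @Order.TotalTheory.arg_maxP _ _ I i0 predT (fun i => cabs (F i)) isT.
have {imax}imax j : cabs (F j) <= cabs (F i) by exact: imax.
have Fi0 : 0 < cabs (F i).
  by apply: lt_le_trans (imax i0); apply: le_lt_trans F0; rewrite mulr_ge0 ?cabs_ge0.
have I0 : 0 < #|I|%:R :> R by rewrite ltr0n; apply/card_gt0P; exists i.
have I1 : 1 <= #|I|%:R :> R by rewrite ler1n -(ltr0n R).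
have [[j [ij Fj]]|small] :=
    pselect (exists j, i != j /\ cabs (F i) <= (2 * #|I|%:R) * cabs (F j)).
  exists i, j; split=> //; first by rewrite -cabs_gt0.
    by rewrite -cabs_gt0; nra.
  by have := imax j; nra.
suff : cabs (F i) <= 2 * cabs (\sum_i F i) by have := imax i0; lra.
have : cabs (\sum_(j | j != i) F j) <= cabs (F i) / 2.
  apply: le_trans (cabs_sum _ _ _) _.
  apply: (@le_trans _ _ (\sum_(j : I | j != i) cabs (F i) / (2 * #|I|%:R))).
    apply: ler_sum => j ji; rewrite ler_pdivlMr ?mulr_gt0// mulrC leNgt.
    by apply: contra_notN small => /ltW Fj; exists j; rewrite eq_sym.
  rewrite sumr_const -[leLHS]mulr_natr.
  have -> : cabs (F i) / (2 * #|I|%:R) = cabs (F i) / 2 / #|I|%:R.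
    by rewrite invfM mulrA.
  rewrite -mulrA ler_piMr ?divr_ge0 ?(ltW Fi0)//.
  by rewrite ler_pdivrMl// mulr1 ler_nat max_card.
have := cabs_dist (F i) (- \sum_(j | j != i) F j).
by rewrite opprK cabsN [X in _ -> _ -> _ <= 2 * cabs X](bigD1 i)//=; lra.
Qed.

End MonomialPairs.

(** * Power series with polynomial coefficients on the circle *)

Section PolyNorm.
Variable R : realType.
Implicit Types (p q : {poly R[i]}) (w y : R[i]).

Definition pnorm p : R := \sum_(k < size p) cabs p`_k.

Lemma pnorm_ge0 p : 0 <= pnorm p.
Proof. by apply: sumr_ge0 => k _; exact: cabs_ge0. Qed.

Lemma sum_coef_le_pnorm p n : \sum_(k < n) cabs p`_k <= pnorm p.
Proof.
apply: (@le_trans _ _ (\sum_(k < n + size p) cabs p`_k)).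
  by rewrite big_split_ord /= lerDl sumr_ge0// => k _; exact: cabs_ge0.
rewrite addnC big_split_ord /= -[leRHS]addr0 lerD2l.
by rewrite big1// => k _; rewrite nth_default ?cabs0// leq_addr.
Qed.

Lemma cabs_horner_le p y : cabs y = 1 -> cabs p.[y] <= pnorm p.
Proof.
move=> y1; rewrite horner_coef; apply: le_trans (cabs_sum _ _ _) _.
by apply: ler_sum => k _; rewrite cabsM cabsX y1 expr1n mulr1.
Qed.

(** Each coefficient of the quotient is, up to powers of [w], a partial sum of
    the coefficients of [p]. *)
Lemma pnorm_divp_XsubC p w : cabs w = 1 -> root p w ->
  pnorm (p %/ ('X - w%:P)) <= (size p)%:R * pnorm p.
Proof.
move=> w1 /factor_theorem[q ->]; rewrite mulpK ?polyXsubC_eq0//.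
set P := q * _.
have coefP k : P`_k = (if k is k'.+1 then q`_k' else 0) - q`_k * w.
  by rewrite /P mulrBr coefB coefMC coefMX; case: k.
have qk k : cabs q`_k <= pnorm P.
  apply: le_trans (sum_coef_le_pnorm P k.+1).
  elim: k => [|k IHk].
    by rewrite big_ord1 coefP sub0r cabsN cabsM w1 mulr1.
  rewrite big_ord_recr /=; apply: (@le_trans _ _ (cabs q`_k + cabs P`_k.+1)).
    have -> : cabs q`_k.+1 = cabs (q`_k - P`_k.+1).
      by rewrite coefP opprB addrC subrK cabsM w1 mulr1.
    exact: cabsB.
  by rewrite lerD2r.
have sq : (size q <= size P)%N.
  have [->|q0] := eqVneq q 0; first by rewrite size_poly0.
  by rewrite size_Mmonic ?monicXsubC// size_XsubC addn2.
rewrite {1}/pnorm; apply: (@le_trans _ _ (\sum_(k < size q) pnorm P)).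
  by apply: ler_sum => k _.
by rewrite sumr_const card_ord -[leLHS]mulr_natl ler_wpM2r ?pnorm_ge0// ler_nat.
Qed.

End PolyNorm.

Lemma min_exprn_le_prod (R : realDomainType) (T : eqType) (s : seq T) (a : T -> R) :
  (forall x, 0 <= a x) -> (0 < size s)%N ->
  exists2 x, x \in s & a x ^+ size s <= \prod_(y <- s) a y.
Proof.
move=> a0; case: s => // x s _.
have [m ms mmin] : exists2 m, m \in x :: s & forall y, y \in x :: s -> a m <= a y.
  elim: s x => [x|y s IHs x].
    by exists x; rewrite ?mem_head// => y; rewrite inE => /eqP ->.
  have [m ms mmin] := IHs y; have [am|am] := leP (a x) (a m).
    exists x; rewrite ?mem_head// => u; rewrite inE => /predU1P[->//|/mmin].
    exact: le_trans.
  exists m; first by rewrite inE ms orbT.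
  by move=> u; rewrite inE => /predU1P[->|/mmin//]; exact: ltW.
exists m => //; elim: (x :: s) mmin => [|y t IHt] mmin; first by rewrite big_nil.
rewrite big_cons exprS ler_pM ?exprn_ge0//; first by rewrite mmin ?mem_head.
by apply: IHt => u ut; rewrite mmin// inE ut orbT.
Qed.

Section CircleSeries.
Variable R : realType.
Variables b z : R[i].
Hypotheses (b0 : 0 < cabs b) (b1 : cabs b < 1) (z1 : cabs z = 1)
  (z_nontorsion : forall k, (0 < k)%N -> z ^+ k != 1).
Implicit Types (P : nat -> {poly R[i]}) (W : R) (w : R[i]).

Let r := cabs b.

(** The series is [\sum_l (b ^ n) ^ l * (P l).[z ^ n]].  Absolute convergence at
    [n = M], with bound [W], plays the part of a radius of convergence; the bound on
    the sizes lets division by a linear factor cost only a factor linear in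
    [l]. *)
Definition circle_series P (M : nat) W : Prop :=
  (forall l, (size (P l) <= l.+1)%N) /\
  forall L, \sum_(0 <= l < L) (r ^+ M) ^+ l * pnorm (P l) <= W.

Definition psum P n L := \sum_(0 <= l < L) (b ^+ n) ^+ l * (P l).[z ^+ n].

(** Phrased with partial sums so that dividing the series by a nonzero number
    needs no manipulation of limits. *)
Definition vanishes P n : Prop :=
  forall e : R, 0 < e -> exists L0, forall L, (L0 <= L)%N -> cabs (psum P n L) <= e.

Lemma circle_series_ge0 P M W : circle_series P M W -> 0 <= W.
Proof. by move=> [_ /(_ 0%N)]; rewrite big_geq. Qed.

Lemma vanishes_psum_le P M W n L : circle_series P M W -> (M <= n)%N ->
  vanishes P n -> cabs (psum P n L) <= (r ^+ (n - M)) ^+ L * W.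
Proof.
move=> [_ HW] Mn vP; apply/ler_addgt0Pr => e /vP[L0 HL0].
have := HL0 (maxn L0 L) (leq_maxl _ _); set L' := maxn L0 L.
have LL' : (L <= L')%N by exact: leq_maxr.
have -> : psum P n L = psum P n L' -
    \sum_(L <= l < L') (b ^+ n) ^+ l * (P l).[z ^+ n].
  suff -> : psum P n L' = psum P n L +
      \sum_(L <= l < L') (b ^+ n) ^+ l * (P l).[z ^+ n] by rewrite addrK.
  by rewrite /psum (big_cat_nat (n := L)).
move=> Le; apply: le_trans (cabsB _ _) _; rewrite addrC lerD//.
apply: le_trans (cabs_sum _ _ _) _.
have s0 : 0 <= r ^+ (n - M) by rewrite exprn_ge0 ?cabs_ge0.
have s1 : r ^+ (n - M) <= 1 by rewrite exprn_ile1 ?cabs_ge0// ltW.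
apply: le_trans (ler_wpM2l (exprn_ge0 _ s0) (HW L')).
rewrite mulr_sumr [leRHS](big_cat_nat (n := L))//=.
rewrite -[leLHS]add0r lerD//.
  apply: sumr_ge0 => l _.
  by rewrite !mulr_ge0 ?pnorm_ge0// ?exprn_ge0// ?exprn_ge0// cabs_ge0.
rewrite big_nat [leRHS]big_nat; apply: ler_sum => l /andP[Ll _].
rewrite cabsM !cabsX -/r -{1}(subnK Mn) exprD exprMn -mulrA.
have r0 : 0 <= r by exact: cabs_ge0.
rewrite ler_pM ?exprn_ge0//.
- by rewrite mulr_ge0 ?exprn_ge0 ?cabs_ge0.
- by rewrite ler_wiXn2l.
rewrite ler_wpM2l ?exprn_ge0 ?cabs_ge0// cabs_horner_le//.
by rewrite cabsX z1 expr1n.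
Qed.

(** Raising the exponent [M] by one absorbs the factor [l + 1] lost in
    [pnorm_divp_XsubC]. *)
Lemma circle_series_div P M W w : cabs w = 1 -> circle_series P M W ->
  (forall l, root (P l) w) ->
  circle_series (fun l => P l %/ ('X - w%:P)) M.+1 (W * ((1 - r)^-1 + 1)).
Proof.
move=> w1 [sP HW] Pw; split=> [l|L].
  by apply: leq_trans (sP l); rewrite size_divp ?polyXsubC_eq0// leq_subr.
rewrite mulrC; have r10 : 0 < 1 - r by rewrite subr_gt0.
have c0 : 0 <= (1 - r)^-1 + 1 by rewrite addr_ge0// invr_ge0 ltW.
apply: le_trans (ler_wpM2l c0 (HW L)); rewrite mulr_sumr.
apply: ler_sum => l _; rewrite exprSr exprMn -mulrA [leRHS]mulrCA.
rewrite ler_wpM2l ?exprn_ge0 ?exprn_ge0 ?cabs_ge0//.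
have rl0 : 0 <= r ^+ l by rewrite exprn_ge0 ?cabs_ge0.
have rl1 : r ^+ l <= 1 by rewrite exprn_ile1 ?cabs_ge0// ltW.
apply: le_trans (ler_wpM2l rl0 (pnorm_divp_XsubC w1 (Pw l))) _.
rewrite mulrA ler_wpM2r ?pnorm_ge0//.
apply: (@le_trans _ _ (r ^+ l * l.+1%:R)); first by rewrite ler_wpM2l// ler_nat.
have := @mulrn_exprn_le1 _ r l; rewrite cabs_ge0 (ltW b1) => /(_ isT).
rewrite mulrAC -ler_pdivlMr// mul1r -natr1; lra.
Qed.

Lemma vanishes_div P n w : (forall l, root (P l) w) -> z ^+ n != w ->
  vanishes P n -> vanishes (fun l => P l %/ ('X - w%:P)) n.
Proof.
move=> Pw zw vP e e0; have d0 : 0 < cabs (z ^+ n - w) by rewrite cabs_gt0 subr_eq0.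
have [L0 HL0] := vP _ (mulr_gt0 e0 d0).
exists L0 => L /HL0; suff -> : psum P n L =
    psum (fun l => P l %/ ('X - w%:P)) n L * (z ^+ n - w).
  by rewrite cabsM ler_pM2r.
rewrite /psum mulr_suml; apply: eq_bigr => l _; rewrite -mulrA; congr (_ * _).
have -> : z ^+ n - w = ('X - w%:P).[z ^+ n] by rewrite hornerXsubC.
by rewrite -hornerM divpK// dvdp_XsubCl.
Qed.

(** If [w] is not a common root, the truncated expansion at [w] contains a pure
    power of [b ^ n], which dominates the tail of the series; so cancellation
    must occur between two monomials in [b ^ n] and [z ^ n - w]. *)
Lemma vanishing_near_nonroot P M W w C (D K : nat) : circle_series P M W ->
  ~~ root (P K) w -> (0 < D)%N ->
  exp_gapped R [set n | vanishes P n /\ cabs (z ^+ n - w) ^+ D <= C * r ^+ n].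
Proof.
move=> cP PKw D0; have [sP _] := cP.
pose Q l := P l \Po ('X + w%:P).
have sQ l : (l < K.+1)%N -> (size (Q l) <= K.+1)%N.
  by move=> lK; rewrite /Q size_comp_poly2 ?size_XaddC// (leq_trans (sP l)).
pose I := ('I_K.+1 * 'I_K.+1)%type.
pose c (i : I) := cabs (Q i.1)`_i.2.
pose F n (i : I) := (b ^+ n) ^+ i.1 * ((Q i.1)`_i.2 * (z ^+ n - w) ^+ i.2).
have FE n : psum P n K.+1 = \sum_i F n i.
  rewrite /psum big_mkord -(pair_big xpredT xpredT (fun i j => F n (i, j)))/=.
  apply: eq_bigr => l _.
  rewrite -mulr_sumr; congr (_ * _).
  rewrite -(horner_coef_wide (z ^+ n - w) (sQ l (ltn_ord l))) /Q horner_comp.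
  by rewrite !hornerE subrK.
pose i0 : I := (ord_max, ord0).
have cF n i : cabs (F n i) = c i * (r ^+ (n * i.1) * cabs (z ^+ n - w) ^+ i.2).
  by rewrite /F !cabsM !cabsX -exprM /c mulrCA.
have cpos n i : F n i != 0 -> 0 < c i.
  by rewrite cabs_gt0; apply: contraNneq => E; rewrite /F E mul0r mulr0.
have ci0 : 0 < c i0.
  by rewrite cabs_gt0 /Q /= -horner_coef0 horner_comp !hornerE.
have W0 := circle_series_ge0 cP.
have r01 : 0 <= r < 1 by rewrite cabs_ge0.
have rM0 : 0 < (r ^+ M) ^+ K.+1 by rewrite !exprn_gt0.
have [N HN] := exprn_small (2 * W) r01 (mulr_gt0 ci0 rM0).
pose H : R := 2 * #|{: I}|%:R.
pose A (ij : I * I) := [set n | cabs (z ^+ n - w) ^+ D <= C * r ^+ n /\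
  [/\ F n ij.1 != 0, F n ij.2 != 0, cabs (F n ij.1) <= H * cabs (F n ij.2) &
  cabs (F n ij.2) <= H * cabs (F n ij.1)]].
have H0 : 0 < H.
  by rewrite mulr_gt0// ltr0n; apply/card_gt0P; exists i0.
have Agap i j : i != j -> exp_gapped R (A (i, j)).
  wlog ij : i j / (i.2 <= j.2)%N => [wl ij|].
    have [/wl|/ltnW/wl] := leqP i.2 j.2; first exact.
    rewrite eq_sym => /(_ ij); apply: exp_gappedS.
    by move=> n [nC [? ? ? ?]]; split.
  move=> inej; have [ci|ci] := ltP 0 (c i); last first.
    apply: (@exp_gapped_bounded _ _ 0) => n [_ [/= + _ _ _]].
    by move=> /cpos; rewrite ltNge ci.
  have [cj|cj] := ltP 0 (c j); last first.
    apply: (@exp_gapped_bounded _ _ 0) => n [_ [/= _ + _ _]].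
    by move=> /cpos; rewrite ltNge cj.
  apply: (@exp_gapped_comparable R r z w b0 b1 z1 z_nontorsion (A (i, j))
    (c i) (c j) H C i.1 i.2 j.1 j.2 D) => //.
  by move=> n [nC [/= _ Fj ? ?]]; rewrite -!cF; split=> //; rewrite cabs_gt0.
apply: (@exp_gapped_tail _ _ (maxn M N)).
apply: exp_gappedS (@exp_gapped_bigU _ _ [seq ij <- enum {: I * I} | ij.1 != ij.2] A _).
  move=> n [[vn nC]] /=; rewrite geq_max => /andP[Mn Nn].
  have [|i [j [ij Fi Fj Hij Hji]]] := @comparable_terms R I (F n) i0.
    rewrite -FE cF /= expr0 mulr1.
    apply: le_lt_trans (ler_wpM2l _ (vanishes_psum_le K.+1 cP Mn vn)) _ => //.
    have rnK : 0 < r ^+ (n * K) by rewrite exprn_gt0.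
    rewrite -(ltr_pM2r rM0).
    have -> : 2 * ((r ^+ (n - M)) ^+ K.+1 * W) * (r ^+ M) ^+ K.+1 =
        2 * W * ((r ^+ (n - M)) ^+ K.+1 * (r ^+ M) ^+ K.+1) by ring.
    rewrite -exprMn -exprD subnK// exprS -exprM mulrA mulrAC [ltRHS]mulrAC.
    by rewrite [ltLHS]mulrAC ltr_pM2r// HN.
  exists (i, j); first by rewrite mem_filter mem_enum /= ij.
  by split.
by move=> [i j]; rewrite mem_filter => /andP[/Agap].
Qed.

(** As [z] is not a root of unity, [z ^ n = w] for at most one [n]; away from it
    a common factor [X - w] of the coefficients can be removed, and this ends
    because it lowers the degree of the nonzero [P l0]. *)
Lemma vanishing_near P M W w C (D l0 : nat) : circle_series P M W ->
  cabs w = 1 -> P l0 != 0 -> (0 < D)%N ->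
  exp_gapped R [set n | vanishes P n /\ cabs (z ^+ n - w) ^+ D <= C * r ^+ n].
Proof.
move=> + w1 + D0; have [k] := ubnP (size (P l0)).
elim: k P M W => // k IHk P M W; rewrite ltnS => sk cP Pl0.
have [Pw|] := pselect (forall l, root (P l) w); last first.
  by move=> /existsNP[K /negP PK]; exact: (vanishing_near_nonroot C cP PK D0).
have [n0 zn0] : exists n0, forall n, z ^+ n = w -> n = n0.
  have [[n0 n0w]|nw] := pselect (exists n0, z ^+ n0 = w); last first.
    by exists 0%N => n nw'; case: nw; exists n.
  exists n0 => n nw.
  wlog lt : n n0 n0w nw / (n < n0)%N => [wl|].
    by have [/wl|/wl h|//] := ltngtP n n0; [exact|apply/esym/h].
  have := z_nontorsion (_ : 0 < n0 - n)%N; rewrite subn_gt0 => /(_ lt)/eqP[].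
  have : z ^+ n != 0 by rewrite -cabs_gt0 cabsX z1 expr1n.
  by move=> /mulIf; apply; rewrite mul1r -exprD subnK ?(ltnW lt)// n0w nw.
have P'0 : P l0 %/ ('X - w%:P) != 0.
  by rewrite dvdp_div_eq0 ?dvdp_XsubCl.
have sP' : (size (P l0 %/ ('X - w%:P))%R < k)%N.
  rewrite size_divp ?polyXsubC_eq0// size_XsubC /=; apply: leq_trans sk.
  by rewrite subn1 prednK// lt0n size_poly_eq0.
have := IHk _ _ _ sP' (circle_series_div w1 cP Pw) P'0.
have gn0 : exp_gapped R [set n0].
  by apply: (@exp_gapped_bounded _ _ n0.+1) => n ->.
move=> g; apply: exp_gappedS (exp_gappedU gn0 g) => n [vn nC].
have [/zn0 ->|/eqP zw] := pselect (z ^+ n = w); first by left.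
by right; split=> //; exact: vanishes_div.
Qed.

(** The first nonzero coefficient [P l] takes a value of order at most [|b| ^ n] at
    [z ^ n], which is therefore close to one of its roots; only the roots on the
    unit circle can be approached. *)
Lemma circle_series_gapped P M W (l0 : nat) : circle_series P M W -> P l0 != 0 ->
  exp_gapped R [set n | vanishes P n].
Proof.
move=> cP Pl0; have ex0 : exists l, P l != 0 by exists l0.
have {Pl0 ex0}[{}l0 Pl0 min0] := ex_minnP ex0.
have r01 : 0 <= r < 1 by rewrite cabs_ge0.
have [ws Pws] := closed_field_poly_normal (P l0).
pose D := size ws; pose lc := cabs (lead_coef (P l0)).
have lc0 : 0 < lc by rewrite cabs_gt0 lead_coef_eq0.
pose C := W / (r ^+ M) ^+ l0.+1 / lc.
have near n : vanishes P n -> (M <= n)%N ->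
    \prod_(w <- ws) cabs (z ^+ n - w) <= C * r ^+ n.
  move=> vn Mn; have := vanishes_psum_le l0.+1 cP Mn vn.
  rewrite /psum big_nat_recr//= big_nat big1 ?add0r; last first.
    move=> l /andP[_ ll0]; have [->|/min0] := eqVneq (P l) 0.
      by rewrite horner0 mulr0.
    by rewrite leqNgt ll0.
  rewrite cabsM !cabsX -/r {1}Pws hornerZ horner_prod cabsM -/lc cabs_prod.
  under eq_bigr do rewrite hornerXsubC.
  set p := \prod_(_ <- _) _ => h.
  rewrite /C mulrAC ler_pdivlMr// mulrAC ler_pdivlMr ?exprn_gt0// ?exprn_gt0//.
  have rn0 : 0 < (r ^+ n) ^+ l0 by rewrite !exprn_gt0.
  have rM0 : 0 < (r ^+ M) ^+ l0.+1 by rewrite !exprn_gt0.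
  rewrite -(ler_pM2l rn0).
  have -> : (r ^+ n) ^+ l0 * (p * lc * (r ^+ M) ^+ l0.+1) =
    (r ^+ n) ^+ l0 * (lc * p) * (r ^+ M) ^+ l0.+1 by ring.
  apply: le_trans (ler_wpM2r (ltW rM0) h) _.
  by rewrite mulrAC -exprMn -exprD subnK// exprSr -mulrA [r ^+ n * W]mulrC.
apply: (@exp_gapped_tail _ _ M).
have [D0|D0] := posnP D.
  apply: (@exp_gapped_small R r b0 b1 _ 1 C 1) => // n [vn Mn].
  by have := near n vn Mn; rewrite (size0nil D0) big_nil muln1.
pose A w := [set n | vanishes P n /\ cabs (z ^+ n - w) ^+ D <= C * r ^+ n].
apply: exp_gappedS (@exp_gapped_bigU _ _ ws A _).
  move=> n [vn Mn]; have nC := near n vn Mn.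
  have [w ws_w wn] := min_exprn_le_prod (fun w => cabs_ge0 (z ^+ n - w)) D0.
  by exists w => //; split=> //; exact: le_trans wn nC.
move=> w _; have [w1|w1] := eqVneq (cabs w) 1.
  exact: vanishing_near cP w1 Pl0 D0.
have d0 : 0 < `|1 - cabs w| ^+ D by rewrite exprn_gt0// normr_gt0 subr_eq0 eq_sym.
apply: (@exp_gapped_small R r b0 b1 _ _ C 1 d0) => // n [_ nC].
rewrite muln1; apply: le_trans nC; rewrite lerXn2r ?nnegrE ?cabs_ge0//.
have zn : cabs (z ^+ n) = 1 by rewrite cabsX z1 expr1n.
rewrite -zn ler_norml; apply/andP; split; last exact: cabs_dist.
by have := cabs_dist w (z ^+ n); rewrite cabs_distC; lra.
Qed.

End CircleSeries.

(** * Almost periodicity of the zero set *)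

Lemma exprn_inj (R : realType) (s : R) (m n : nat) :
  0 < s -> s < 1 -> s ^+ m = s ^+ n -> m = n.
Proof.
move=> s0 s1 E; apply/eqP; rewrite eqn_leq -!(ler_iXn2l s0 s1) E.
by rewrite !lexx.
Qed.

Section AlmostPeriodic.
Variable R : realType.

Lemma exp_gapped_almost_periodic (A : set nat) :
  exp_gapped R A -> almost_periodic R A.
Proof.
move=> gA; exists [::], A; split; first exact: exp_gapped_very_sparse.
by rewrite -[LHS]set0U; congr (_ `|` _); apply/seteqP; split=> // n [].
Qed.

(** A class whose elements beyond [M] all lie in [A] contributes a progression
    started beyond [M]; the rest of [A] is bounded. *)
Lemma almost_periodic_residues (A : set nat) (N M : nat) : (0 < N)%N ->
  (forall r, (forall n, n = r %[mod N] -> (M < n)%N -> A n) \/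
    exists B, forall n, n = r %[mod N] -> A n -> (n < B)%N) ->
  almost_periodic R A.
Proof.
move=> N0 HA.
pose full r := forall n, n = r %[mod N] -> (M < n)%N -> A n.
have /choice[B HB] : forall r, exists b, ~ full r ->
    forall n, n = r %[mod N] -> A n -> (n < b)%N.
  by move=> r; have [fr|[b Hb]] := HA r; [exists 0%N|exists b].
pose start r := (r + N * M.+1)%N.
pose s := [seq (start r, N) | r <- iota 0 N & `[< full r >]].
pose AP := \bigcup_(p in [set` s]) arith_prog p.1 p.2.
exists s, (A `\` AP); split.
  apply/exp_gapped_very_sparse.
  apply: (@exp_gapped_bounded _ _ (maxn (N + N * M.+1) (\max_(r < N) B r))).
  move=> n [An nAP]; have rN : (n %% N < N)%N by rewrite ltn_mod.
  have nr : n = n %% N %[mod N] by rewrite modn_mod.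
  have [fr|/HB/(_ n nr An) nB] := pselect (full (n %% N)%N); last first.
    rewrite leq_max orbC (leq_trans nB)//.
    exact: (leq_bigmax (F := fun r : 'I_N => B r) (Ordinal rN)).
  rewrite leq_max ltnNge; apply/orP; left; apply/negP => le_n; apply: nAP.
  exists (start (n %% N)%N, N).
    apply: map_f; rewrite mem_filter; apply/andP; split; first exact/asboolP.
    by rewrite mem_iota.
  exists (n %/ N - M.+1)%N => //=; rewrite /start.
  have le2 : (M.+1 <= n %/ N)%N.
    by rewrite leq_divRL// mulnC (leq_trans _ le_n)// leq_addl.
  by rewrite -addnA -mulnDr subnKC// addnC mulnC -divn_eq.
apply/seteqP; split=> [n An|n [|[]//]].
  by have [?|?] := pselect (AP n); [left|right].
move=> [[a d] /= /mapP[r]]; rewrite mem_filter => /andP[/asboolP fr _] [-> ->].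
move=> [m _ <-]; apply: fr; rewrite /start; last nia.
by rewrite -addnA -mulnDr addnC mulnC modnMDl.
Qed.

End AlmostPeriodic.

Lemma sum_eqn (n j : nat) : (\sum_(k < n) (k == j :> nat) = (j < n))%N.
Proof.
elim: n => [|n IHn]; first by rewrite big_ord0.
by rewrite big_ord_recr /= IHn ltnS [in RHS]leq_eqVlt eq_sym; case: ltngtP.
Qed.

Section Analytic.
Variables (R : realType) (f : nat -> nat -> R[i]) (a1 a2 : R[i]) (M : nat).
Hypotheses (a1_lt1 : cabs a1 < 1) (a2_lt1 : cabs a2 < 1).
Hypothesis f_cvg : forall n, (M <= n)%N -> ps2_cvg f (a1 ^+ n, a2 ^+ n).

Let c (i : nat * nat) := f i.1 i.2.
Let v (i : nat * nat) := a1 ^+ i.1 * a2 ^+ i.2.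
Let g n := ps2_eval f (a1 ^+ n, a2 ^+ n).
Let Z := [set n : nat | (M <= n)%N /\ g n = 0].

Lemma has_sum_monomials n : (M <= n)%N -> has_sum (fun i => c i * v i ^+ n) (g n).
Proof.
move=> /f_cvg/has_sum_ps2 fs e /fs [J0 HJ0]; exists J0 => J /HJ0.
congr (cabs (_ - _) <= _); apply: eq_bigr => i _; rewrite /ps2_term /c /v /=.
by rewrite -!exprM exprMn -!exprM mulrA ![(n * _)%N]mulnC.
Qed.

Lemma finite_levels (t : R) : 0 < t ->
  exists F : {fset nat * nat}, forall i, (i \in F) = (t < cabs (v i)).
Proof.
move=> t0.
have a10 : 0 <= cabs a1 < 1 by rewrite cabs_ge0.
have a20 : 0 <= cabs a2 < 1 by rewrite cabs_ge0.
have [J1 HJ1] := exprn_small 1 a10 t0.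
have [J2 HJ2] := exprn_small 1 a20 t0.
pose s := [seq (j, k) | j <- iota 0 J1, k <- iota 0 J2].
exists [fset i in s | t < cabs (v i)]%fset => i; rewrite !inE.
rewrite andb_idl// /v cabsM !cabsX => tv; case: i tv => j k /= tv.
have le1 (x : R) m : 0 <= x < 1 -> 0 <= x ^+ m <= 1.
  by move=> /andP[x0 x1]; rewrite exprn_ge0 ?exprn_ile1// ltW.
have /andP[j0 j1] := le1 _ j a10; have /andP[k0 k1] := le1 _ k a20.
apply/allpairsP; exists (j, k); split=> //; rewrite mem_iota /= add0n ltnNge.
  apply/negP => /HJ1; rewrite mul1r => jt; nra.
by apply/negP => /HJ2; rewrite mul1r => kt; nra.
Qed.

Lemma almost_periodic_torsion (N : nat) : (0 < N)%N ->
  (forall i j, 0 < cabs (v i) -> cabs (v i) = cabs (v j) -> v i ^+ N = v j ^+ N) ->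
  almost_periodic R Z.
Proof.
move=> N0 vN; apply: (@almost_periodic_residues _ _ N M N0) => r.
have [g0|[B HB]] := exp_sum_progression has_sum_monomials finite_levels r vN.
  by left=> n nr Mn; split; [exact: ltnW|exact: g0].
by right; exists B => n nr [Mn gn]; exact: HB.
Qed.

(** Without a multiplicative relation between the moduli, monomials of equal
    nonzero modulus are equal. *)
Lemma almost_periodic_independent :
  (forall p q, (0 < p)%N -> (0 < q)%N -> a1 != 0 -> a2 != 0 ->
    cabs a1 ^+ q != cabs a2 ^+ p) ->
  almost_periodic R Z.
Proof.
move=> indep; apply: (@almost_periodic_torsion 1) => // -[i k] [j l].
rewrite !expr1 /v /= !cabsM !cabsX.
have inj (x : R[i]) m n : cabs x < 1 -> cabs x ^+ m = cabs x ^+ n ->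
    0 < cabs x ^+ m -> x ^+ m = x ^+ n.
  move=> x1; have [->|x0] := eqVneq x 0.
    rewrite cabs0 !expr0n; case: m n => [|m] [|n] //=; rewrite ?ltxx// => /eqP.
    by rewrite oner_eq0.
  by move=> /exprn_inj -> //; rewrite cabs_gt0.
wlog ij : i j k l / (i <= j)%N => [wl v0 E|].
  have [ij|/ltnW ji] := leqP i j; first exact: wl.
  by apply/esym/wl => //; rewrite -?E.
move=> v0 E.
move: (v0); rewrite lt_def mulf_eq0 negb_or -andbA => /and3P[a1i a2k _].
have {}a2k : 0 < cabs a2 ^+ k by rewrite lt_def a2k exprn_ge0 ?cabs_ge0.
have {}a1i : 0 < cabs a1 ^+ i by rewrite lt_def a1i exprn_ge0 ?cabs_ge0.
have [ij'|nij] := eqVneq i j.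
  rewrite {}ij' in ij v0 E a1i *; congr (_ * _); apply: inj => //.
  by apply: (mulfI (lt0r_neq0 a1i)).
have {nij ij} lt_ij : (i < j)%N by rewrite ltn_neqAle nij.
have a10 : 0 < cabs a1.
  rewrite lt_def cabs_ge0 andbT; apply: contraTneq v0 => a10.
  by rewrite E a10 expr0n eqn0Ngt (leq_trans _ lt_ij)// mul0r ltxx.
have [kl|lk] := leqP k l.
  have lt1 : cabs a1 ^+ j * cabs a2 ^+ k < cabs a1 ^+ i * cabs a2 ^+ k.
    by rewrite ltr_pM2r// ltr_iXn2l.
  have le1 : cabs a1 ^+ j * cabs a2 ^+ l <= cabs a1 ^+ j * cabs a2 ^+ k.
    by rewrite ler_pM2l ?exprn_gt0// ler_wiXn2l ?cabs_ge0// ltW.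
  by have := le_lt_trans le1 lt1; rewrite E ltxx.
have a20 : 0 < cabs a2.
  rewrite lt_def cabs_ge0 andbT; apply: contraTneq a2k => ->.
  by rewrite expr0n eqn0Ngt (leq_trans _ lk)// ltxx.
have := indep (k - l)%N (j - i)%N; rewrite !subn_gt0 lk lt_ij -!cabs_gt0 a10 a20.
move=> /(_ isT isT isT isT)/eqP[]; symmetry.
apply: (mulfI (lt0r_neq0 a1i)); apply: (mulIf (lt0r_neq0 (exprn_gt0 l a20))).
by rewrite -mulrA -!exprD subnK ?(ltnW lk)// subnKC ?(ltnW lt_ij).
Qed.

Section Dependent.
Variables (p q : nat) (b z : R[i]).
Hypotheses (p0 : (0 < p)%N) (q0 : (0 < q)%N) (b0 : 0 < cabs b) (b1 : cabs b < 1)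
  (z1 : cabs z = 1) (a1E : a1 = b ^+ p) (a2E : a2 = b ^+ q * z).

Let wt (i : nat * nat) := (p * i.1 + q * i.2)%N.

Lemma monomE i : v i = b ^+ wt i * z ^+ i.2.
Proof. by rewrite /v a1E a2E /wt exprMn -!exprM exprD mulrA. Qed.

Lemma cabs_monomE i : cabs (v i) = cabs b ^+ wt i.
Proof. by rewrite monomE cabsM !cabsX z1 expr1n mulr1. Qed.

Let box L := [seq (j, k) | j <- iota 0 L, k <- iota 0 L].
Let level l : {fset nat * nat} := [fset i in box l.+1 | wt i == l]%fset.
Let below L : {fset nat * nat} := [fset i in box L | (wt i < L)%N]%fset.

Lemma wt_box L i : (wt i < L)%N -> i \in box L.
Proof.
case: i => j k; rewrite /wt /= => wtL; apply/allpairsP; exists (j, k).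
by split; rewrite // mem_iota /=; nia.
Qed.

Lemma in_level l i : (i \in level l) = (wt i == l).
Proof. by rewrite !inE andb_idl// => /eqP wl; apply: (@wt_box l.+1); rewrite wl. Qed.

Lemma in_below L i : (i \in below L) = (wt i < L)%N.
Proof. by rewrite !inE /= andb_idl//; exact: wt_box. Qed.

Lemma sum_levels (V : nmodType) (X : nat * nat -> V) L :
  \sum_(0 <= l < L) \sum_(i <- level l) X i = \sum_(i <- below L) X i.
Proof.
elim: L => [|L IHL].
  rewrite big_geq//; have -> : below 0 = fset0.
    by apply/fsetP => i; rewrite in_below inE.
  by rewrite big_seq_fset0.
rewrite big_nat_recr//= IHL -sum_fsetU; last first.
  by apply/fdisjointP => i; rewrite in_below in_level; case: ltngtP.
congr (bigop _ _ _); congr (enum_fset _).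
apply/fsetP => i; rewrite inE in_level !in_below ltnS orbC.
by rewrite [in RHS]leq_eqVlt.
Qed.

(** [(P l).[z ^ n]] times [b ^ (n * l)] collects the terms [c i * v i ^ n] with
    [cabs (v i) = cabs b ^ l]. *)
Let P l : {poly R[i]} := \sum_(i <- level l) c i *: 'X^(i.2).

Lemma psumE n L : psum b z P n L = \sum_(i <- below L) c i * v i ^+ n.
Proof.
rewrite -sum_levels; apply: eq_bigr => l _; rewrite /P horner_sum mulr_sumr.
apply: eq_big_seq => i; rewrite in_level => /eqP <-.
by rewrite hornerZ hornerXn monomE exprMn -!exprM mulrCA ![(n * _)%N]mulnC.
Qed.

Lemma level_circle_series (W : R) :
  (forall J : {fset nat * nat}, \sum_(i <- J) cabs (c i) * cabs (v i) ^+ M <= W) ->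
  circle_series b P M W.
Proof.
move=> HW; split=> [l|L].
  apply: leq_trans (size_sum _ _ _) _; apply/bigmax_leqP_seq => i.
  rewrite in_level => /eqP wl _; apply: leq_trans (size_scale_leq _ _) _.
  by rewrite size_polyXn ltnS -wl (leq_trans (leq_pmull _ q0))// leq_addl.
apply: le_trans (HW (below L)); rewrite -sum_levels; apply: ler_sum => l _.
apply: (@le_trans _ _ (\sum_(i <- level l) cabs b ^+ M ^+ l * cabs (c i))); last first.
  rewrite !big_seq; apply: ler_sum => i; rewrite in_level => /eqP wl.
  by rewrite cabs_monomE wl -!exprM mulrC [(l * M)%N]mulnC.
rewrite -mulr_sumr ler_wpM2l ?exprn_ge0 ?exprn_ge0 ?cabs_ge0//.
rewrite /pnorm; apply: (@le_trans _ _ (\sum_(k < size (P l))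
    \sum_(i <- level l) cabs (c i) * (k == i.2 :> nat)%:R)).
  apply: ler_sum => k _; rewrite /P coef_sum; apply: le_trans (cabs_sum _ _ _) _.
  apply: ler_sum => i _; rewrite coefZ coefXn cabsM.
  by case: eqP => _; rewrite ?cabs1 ?cabs0.
rewrite exchange_big /=; apply: ler_sum => i _; rewrite -mulr_sumr.
rewrite ler_piMr ?cabs_ge0// -natr_sum lern1 sum_eqn.
by case: (_ < _)%N.
Qed.

Lemma almost_periodic_dependent : almost_periodic R Z.
Proof.
have [[N [N0 zN]]|ntors] := pselect (exists N, (0 < N)%N /\ z ^+ N = 1).
  apply: (almost_periodic_torsion N0) => i j _; rewrite !cabs_monomE.
  move=> /(exprn_inj b0 b1) wE; rewrite !monomE wE !exprMn; congr (_ * _).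
  by rewrite -!exprM mulnC exprM zN expr1n mulnC exprM zN expr1n.
have [W [W0 HW]] := exp_sum_bounded has_sum_monomials.
have cP := level_circle_series HW.
have approx n L : (M <= n)%N ->
    cabs (g n - psum b z P n L) <= (cabs b ^+ L) ^+ (n - M) * W.
  move=> Mn; rewrite psumE.
  apply: (exp_sum_tail has_sum_monomials) => // [|i].
    by rewrite exprn_ge0 ?cabs_ge0.
  rewrite in_below -leqNgt => Li; rewrite cabs_monomE.
  by rewrite ler_wiXn2l ?cabs_ge0// ltW.
have small n e : (M < n)%N -> 0 < e ->
    exists L0, forall L, (L0 <= L)%N -> cabs (g n - psum b z P n L) <= e.
  move=> Mn e0; have bn : 0 <= cabs b ^+ (n - M) < 1.
    by rewrite exprn_ge0 ?cabs_ge0//= exprn_ilt1 ?cabs_ge0// -lt0n subn_gt0.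
  have [L0 HL0] := exprn_small W bn e0.
  exists L0 => L /HL0/ltW; apply: le_trans; rewrite mulrC -exprM mulnC exprM.
  exact: approx (ltnW Mn).
have [P0|/existsNP[l0 /eqP Pl0]] := pselect (forall l, P l = 0).
  apply: (@almost_periodic_residues _ _ 1 M) => // r; left=> n _ Mn.
  split; first exact: ltnW.
  apply/eqP; rewrite -cabs_eq0 eq_le cabs_ge0 andbT; apply/ler_addgt0Pr => e e0.
  have [L0 /(_ _ (leqnn _))] := small n e Mn e0.
  rewrite /psum big1 ?subr0 ?add0r// => l _.
  by rewrite P0 horner0 mulr0.
apply: exp_gapped_almost_periodic.
have ntors' k : (0 < k)%N -> z ^+ k != 1.
  by move=> k0; apply/eqP => zk; apply: ntors; exists k.
have gM : exp_gapped R [set M] by apply: (@exp_gapped_bounded _ _ M.+1) => n ->.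
apply: exp_gappedS (exp_gappedU gM (circle_series_gapped b0 b1 z1 ntors' cP Pl0)).
move=> n [Mn gn]; have [->|nM] := eqVneq n M; [by left|right].
have {}Mn : (M < n)%N by rewrite ltn_neqAle eq_sym nM.
move=> e /(small n e Mn)[L0 HL0]; exists L0 => L /HL0.
by rewrite gn sub0r cabsN.
Qed.

End Dependent.

Lemma almost_periodic_zeros : almost_periodic R Z.
Proof.
have [[p [q [p0 q0 a10 a20 pq]]]|indep] := pselect (exists p q,
    [/\ (0 < p)%N, (0 < q)%N, a1 != 0, a2 != 0 & cabs a1 ^+ q = cabs a2 ^+ p]).
  pose b := p.-root a1; have bp : b ^+ p = a1 by rewrite rootCK.
  have b0 : 0 < cabs b.
    by rewrite cabs_gt0; apply: contraNneq a10 => b0; rewrite -bp b0 expr0n eqn0Ngt p0.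
  have b1 : cabs b < 1.
    rewrite ltNge; apply/negP => /(exprn_ege1 p).
    by rewrite -cabsX bp leNgt a1_lt1.
  have bq0 : b ^+ q != 0 by rewrite expf_neq0// -cabs_gt0.
  pose z := a2 / b ^+ q.
  have z1 : cabs z = 1.
    apply/eqP; rewrite -(@pexpr_eq1 _ _ p) ?cabs_ge0//; apply/eqP.
    rewrite -cabsX exprMn exprVn -exprM mulnC exprM bp cabsM cabsV !cabsX pq.
    by rewrite divff// expf_neq0// cabs_eq0.
  apply: (@almost_periodic_dependent p q b z) => //.
  by rewrite mulrC divfK.
apply: almost_periodic_independent => p q p0 q0 a10 a20.
by apply/eqP => pq; apply: indep; exists p, q.
Qed.

End Analytic.

Theorem proposition1p6 (R : realType)
    (f : nat -> nat -> R[i]) (U : set (R[i] * R[i]))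
    (hf : ps2_domain f U)
    (a1 a2 : R[i]) (ha1 : `|a1| < 1) (ha2 : `|a2| < 1)
    (M : nat) (hM : forall n : nat, (M <= n)%N -> U (a1 ^+ n, a2 ^+ n)) :
  almost_periodic R
    [set n : nat | (M <= n)%N /\ ps2_eval f (a1 ^+ n, a2 ^+ n) = 0].
Proof.
have [_ _ Uf] := hf.
by apply: almost_periodic_zeros => [||n /hM/Uf]; rewrite ?cabs_lt1.
Qed.
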